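(* Let $U\subset R^m(-\mathbf d)$ be a quasi-stable module over $R=\mathbb K[x_0,\dots,x_n]$, $\mathbb K$ a field (i.e. $A=\mathbb K$), and let $M\subset R^m(-\mathbf d)$ be a module generated by a $U$-marked basis $F$. (i) The $U$-resolution of $M$ is a minimal free resolution if and only if the $U$-marked basis $F$ is a minimal set of generators of $M$. (ii) If $\beta_{k,j}(M)=r_{k,j}(U)$ for some $k$ and for every $j$, then $\beta_{i,j}(M)=r_{i,j}(U)$ for every $i\geq k$ and every $j$. In particular, if $U$ is stable and $\beta_{k,j}(M)=\beta_{k,j}(U)$ for some $k$ and all $j$, then $\beta_{i,j}(M)=\beta_{i,j}(U)$ for all $i\ge k$ and all $j$.
   Context: $R$ has the standard grading and $x_0<\dots<x_n$. A term of $R$ is a monomial $x^\alpha$; for $x^\alpha\neq1$, $\min(x^\alpha)$ is the smallest variable dividing it. Variables $x_i>\min(x^\alpha)$ are non-multiplicative for $x^\alpha$ (the term $1$ has no non-multiplicative variables). $R^m(-\mathbf d)=\bigoplus_k R(-d_k)\mathbf e_k$, with terms $x^\alpha\mathbf e_k$ of degree $|\alpha|+d_k$. A submodule is monomial if generated by terms; $\mathcal N(U)$ is the set of terms not in the monomial module $U$. Pommaret cone: $\mathcal C(x^\alpha)=\{x^\delta x^\alpha\mid\delta_i=0\ \forall x_i>\min(x^\alpha)\}$ for $x^\alpha\neq 1$, $\mathcal C(1)=$ all terms, $\mathcal C(x^\alpha\mathbf e_k)=\mathcal C(x^\alpha)\mathbf e_k$. A Pommaret basis of $U$ is a set of terms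 generating $U$ whose cones partition the set of terms of $U$; it is unique if it exists, denoted $\mathcal P_U$. $U$ is quasi-stable if it has a finite Pommaret basis, stable if moreover $\mathcal P_U$ is its minimal monomial generating set. A $U$-marked set is a finite set $F=\{f_{\alpha,k}\}_{x^\alpha\mathbf e_k\in\mathcal P_U}$ of homogeneous elements such that $x^\alpha\mathbf e_k$ has coefficient $1$ in $f_{\alpha,k}$ and the support of $f_{\alpha,k}-x^\alpha\mathbf e_k$ is contained in $\mathcal N(U)$. It is a $U$-marked basis if $(R^m(-\mathbf d))_s=(F)_s\oplus\langle\mathcal N(U)_s\rangle_{\mathbb K}$ for all $s$. Then each $f\in(F)$ has a unique writing $f=\sum P_{\gamma,\ell}f_{\gamma,\ell}$ with $P_{\gamma,\ell}\in R$ and all terms of $P_{\gamma,\ell}x^\gamma$ in $\mathcal C(x^\gamma)$. $U$-resolution of $M=(F)$: let $P_0=\bigoplus_{x^\alpha\mathbf e_k\in\mathcal P_U}R(-\deg x^\alpha\mathbf e_k)\mathbf f_{\alpha,k}$ and $\partial_0(\mathbf f_{\alpha,k})=f_{\alpha,k}$. For $x_i>\min(x^\alpha)$ the fundamental syzygy is $S_{i,\alpha,k}=x_i\mathbf f_{\alpha,k}-\sum P_{\gamma,\ell}\mathbf f_{\gamma,\ell}$, where $x_if_{\alpha,k}=\sum P_{\gamma,\ell}f_{\gamma,\ell}$ is the unique writing. The set $F^{\partial_1}$ of all fundamental syzygies is a $U^{(1)}$-marked basis of $\ker\partial_0$ (head term of $S_{i,\alpha,k}$: $x_i\mathbf f_{\alpha,k}$),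 where $U^{(1)}$ is the stable module with Pommaret basis $\{x_i\mathbf f_{\alpha,k}\mid x_i>\min(x^\alpha)\}$. Iterating (known), $F^{\partial_t}$, the set of fundamental syzygies of $F^{\partial_{t-1}}$ (with $F^{\partial_0}=F$), is a marked basis of $\ker\partial_{t-1}$ over a stable module $U^{(t)}$; $\partial_t:P_t\to P_{t-1}$ is the homomorphism whose matrix has the elements of $F^{\partial_t}$ as columns, $P_t$ being graded free with basis indexed by $F^{\partial_t}$. The resulting finite graded free resolution is the $U$-resolution of $M$. Write $P_i=\bigoplus_jR(-j)^{r_{i,j}(U)}$; the numbers $r_{i,j}(U)$ depend only on $\mathcal P_U$. $\beta_{i,j}(M)$ are the graded Betti numbers of $M$, with $\beta_{0,j}(M)$ counting minimal generators of $M$ of degree $j$. *)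

(* Defs.v *)
(* R = {mpoly K[n.+1]} and R^m is the type of column vectors, so
   submodules are generated by the columns of matrices.  The shifts d_k are arbitrary integers.  Ordinals order the variables:
   x_0 < ... < x_n. *)
From HB Require Import structures.
From mathcomp Require Import all_boot all_order all_algebra.
From mathcomp Require Import mpoly.
From Stdlib Require Import ClassicalEpsilon.

Set Implicit Arguments.
Unset Strict Implicit.
Unset Printing Implicit Defensive.

Import GRing.Theory.
Local Open Scope ring_scope.

(* (a, k) stands for the term x^a e_k. *)
Notation term n m := ('X_{1..n.+1} * 'I_m)%type.

Section Terms.
Variable n : nat.

(* The index of min(x^a); it is n.+1 for a = 0, so that the term 1 has no
   non-multiplicative variables. *)
Definition minvar (a : 'X_{1..n.+1}) : nat :=
  find (fun e => e != 0%N) (multinom_val a).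

Definition nonmult (a : 'X_{1..n.+1}) (i : 'I_n.+1) : bool := (minvar a < i)%N.

Definition cone (a b : 'X_{1..n.+1}) : Prop :=
  exists2 c : 'X_{1..n.+1}, (forall i, nonmult a i -> c i = 0%N) & b = (c + a)%MM.

Definition term_cone m (t u : term n m) : Prop := cone t.1 u.1 /\ u.2 = t.2.

Definition term_deg m (d : 'I_m -> int) (t : term n m) : int :=
  (mdeg t.1)%:Z + d t.2.

End Terms.

Section Modules.
Variables (K : fieldType) (n : nat).
Local Notation R := {mpoly K[n.+1]}.

Section Submodules.
Variables (m : nat) (d : 'I_m -> int).
Implicit Types (M U : 'cV[R]_m -> Prop) (v w : 'cV[R]_m) (t : term n m).

Definition tvec t : 'cV[R]_m := 'X_[t.1] *: delta_mx t.2 0.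

Definition coef v t : K := (v t.2 0)@_(t.1).

(* The zero vector is homogeneous of every degree. *)
Definition is_homogeneous (s : int) v : Prop :=
  forall t, coef v t != 0 -> term_deg d t = s.

Definition span p (A : 'M[R]_(m, p)) v : Prop :=
  exists c : 'cV[R]_p, v = A *m c.

Definition generates p (A : 'M[R]_(m, p)) M : Prop :=
  forall v, M v <-> span A v.

Definition span_sub p (A : 'M[R]_(m, p)) (J : {set 'I_p}) v : Prop :=
  exists2 c : 'cV[R]_p, (forall j, j \notin J -> c j 0 = 0) & v = A *m c.

Definition minimal_generators p (A : 'M[R]_(m, p)) M : Prop :=
  generates A M /\
  forall J : {set 'I_p}, (forall v, M v <-> span_sub A J v) -> J = [set: 'I_p].

Definition terms_mx (P : seq (term n m)) : 'M[R]_(m, size P) :=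
  \matrix_(k, j) tvec (tnth (in_tuple P) j) k 0.

(* P enumerates, in some order, the finite Pommaret basis of U.  Thus U is
   quasi-stable iff such a P exists; U is then generated by terms. *)
Definition pommaret_basis U (P : seq (term n m)) : Prop :=
  [/\ uniq P,
      generates (terms_mx P) U,
      forall t, U (tvec t) <-> exists2 p, p \in P & term_cone p t
    & forall p q t, p \in P -> q \in P ->
        term_cone p t -> term_cone q t -> p = q].

Definition stable U (P : seq (term n m)) : Prop :=
  pommaret_basis U P /\ minimal_generators (terms_mx P) U.

Definition supp_outside U v : Prop := forall t, coef v t != 0 -> ~ U (tvec t).

(* Column j of F is the marked element f_{a,k} whose head x^a e_k is the j-th
   term of P. *)
Definition marked_set U (P : seq (term n m)) (F : 'M[R]_(m, size P)) : Prop :=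
  forall j, let h := tnth (in_tuple P) j in
    [/\ exists s, is_homogeneous s (col j F),
        coef (col j F) h = 1
      & supp_outside U (col j F - tvec h)].

(* The two clauses say that (R^m(-d))_s is the sum, and that the sum is direct,
   of (F)_s and the K-span of the degree s terms outside U. *)
Definition marked_basis U (P : seq (term n m)) (F : 'M[R]_(m, size P)) : Prop :=
  marked_set U F /\
  forall s : int,
    (forall v, is_homogeneous s v -> exists f g,
       [/\ span F f /\ is_homogeneous s f,
           supp_outside U g /\ is_homogeneous s g
         & v = f + g]) /\
    (forall v, is_homogeneous s v -> span F v -> supp_outside U v -> v = 0).

Definition pommaret_writing (P : seq (term n m)) (F : 'M[R]_(m, size P))
    v (c : 'cV[R]_(size P)) : Prop :=
  v = F *m c /\
  forall j, let a := (tnth (in_tuple P) j).1 in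
    forall b, b \in msupp (c j 0) -> cone a (b + a)%MM.

(* For a marked basis F and v in (F) this is the unique such writing; it is a
   junk value when no writing exists. *)
Definition writing (P : seq (term n m)) (F : 'M[R]_(m, size P)) v :
    'cV[R]_(size P) :=
  epsilon (inhabits 0) (pommaret_writing F v).

(* Heads x_i f_{a,k} of the fundamental syzygies, the j-th basis vector of the
   new free module being f_{a,k}. *)
Definition syz_heads (P : seq (term n m)) : seq (term n (size P)) :=
  flatten [seq [seq (U_(i)%MM, j) |
                  i <- enum 'I_n.+1 & nonmult (tnth (in_tuple P) j).1 i]
          | j <- enum 'I_(size P)].

(* For h = (U_(i), j), the syzygy obtained by multiplying column j of F by its
   non-multiplicative variable x_i. *)
Definition fund_syz (P : seq (term n m)) (F : 'M[R]_(m, size P))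
    (h : term n (size P)) : 'cV[R]_(size P) :=
  'X_[h.1] *: delta_mx h.2 0 - writing F ('X_[h.1] *: col h.2 F).

Definition fund_syzygies (P : seq (term n m)) (F : 'M[R]_(m, size P)) :
    'M[R]_(size P, size (syz_heads P)) :=
  \matrix_(k, j) fund_syz F (tnth (in_tuple (syz_heads P)) j) k 0.

End Submodules.

(* A sequence of graded free modules and maps ... -> G_1 -> G_0 -> R^m(-d), with G_i of rank
   [rk i] and basis degrees [bdeg i]; matrices act on columns. *)
Record free_complex (m : nat) := FreeComplex {
  rk : nat -> nat;
  bdeg : forall i, 'I_(rk i) -> int;
  aug : 'M[R]_(m, rk 0);
  diff : forall i, 'M[R]_(rk i, rk i.+1)
}.

Section Resolutions.
Variables (m : nat) (d : 'I_m -> int) (M : 'cV[R]_m -> Prop).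

Definition gens_of_degree (G : free_complex m) (i : nat) (j : int) : nat :=
  #|[set a : 'I_(rk G i) | bdeg a == j]|.

Definition graded_free_resolution (G : free_complex m) : Prop :=
  [/\ forall a, is_homogeneous d (bdeg a) (col a (aug G)),
      forall i (a : 'I_(rk G i.+1)),
        is_homogeneous (@bdeg _ G i) (bdeg a) (col a (diff G i)),
      generates (aug G) M,
      forall v, aug G *m v = 0 <-> span (diff G 0) v
    & forall i v, diff G i *m v = 0 <-> span (diff G i.+1) v].

(* The last clause says that the image of G_{i+1} lies in (x_0,...,x_n) G_i. *)
Definition minimal_free_resolution (G : free_complex m) : Prop :=
  graded_free_resolution G /\
  forall i (v : 'cV[R]_(rk G i.+1)) a, ((diff G i *m v) a 0)@_0%MM = 0.

Definition betti_numbers (b : nat -> int -> nat) : Prop :=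
  exists2 G : free_complex m, minimal_free_resolution G &
    forall i j, gens_of_degree G i j = b i j.

End Resolutions.

End Modules.

(* The combinatorial part of the t-th stage: F^{d_t} lies in a free module of
   rank [amb] with basis degrees [shift] and has head terms [heads]. *)
Record stage (n : nat) := Stage {
  amb : nat;
  shift : 'I_amb -> int;
  heads : seq (term n amb)
}.

Definition next_stage n (L : stage n) : stage n :=
  @Stage n (size (heads L))
    (fun j => term_deg (@shift n L) (tnth (in_tuple (heads L)) j))
    (syz_heads (heads L)).

Section UResolution.
Variables (n m : nat) (d : 'I_m -> int) (P : seq (term n m)).

Fixpoint U_stage (t : nat) : stage n :=
  if t is t'.+1 then next_stage (U_stage t') else Stage d P.

Definition U_rank (i : nat) (j : int) : nat :=
  #|[set a | @shift n (U_stage i.+1) a == j]|.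

Variables (K : fieldType) (F : 'M[{mpoly K[n.+1]}]_(m, size P)).

Fixpoint U_elements (t : nat) :
    'M[{mpoly K[n.+1]}]_(amb (U_stage t), size (heads (U_stage t))) :=
  match t with
  | 0 => F
  | t'.+1 => fund_syzygies (U_elements t')
  end.

Definition U_resolution : free_complex K n m :=
  @FreeComplex K n m
    (fun t => size (heads (U_stage t)))
    (fun t => @shift n (U_stage t.+1))
    F
    (fun t => U_elements t.+1).

End UResolution.

(* Main.v *)
Require Import Defs.
From HB Require Import structures.
From mathcomp Require Import all_boot all_order all_algebra.
From mathcomp Require Import mpoly.
From Stdlib Require Import ClassicalEpsilon.
From mathcomp Require Import zify.

Set Implicit Arguments.
Unset Strict Implicit.
Unset Printing Implicit Defensive.

Import GRing.Theory.
Local Open Scope ring_scope.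

(** Two independent facts carry the proof: the U-resolution really is a graded
    free resolution, and constants in its matrices cannot appear once they have
    disappeared.

    Resolution.  Let F be marked over a Pommaret basis P.  If a term x^e e_k
    outside a cone is multiplied by x^d and lands in that cone, with cofactor
    x^c, then c is smaller than d for the lexicographic order in which x_n is
    the largest variable (cone_mlex).  Three consequences follow.  Dividing by F
    inside the cones terminates (cone_division); a lex-maximal cofactor cannot
    cancel, so Pommaret writings are unique (writing_unique); and the writing of
    x_i f_j, for x_i non-multiplicative, involves only cofactors smaller than
    x_i (fund_writing).  By the last point, replacing a non-multiplicative x_i e_j
    through a fundamental syzygy decreases the monomial, so every vector is
    congruent, modulo the fundamental syzygies, to one with multiplicative
    coefficients (multiplicative_mod_syzygies).  If the vector is itself a
    syzygy, uniqueness of writings makes that remainder 0: the fundamental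
    syzygies generate the kernel (ker_fund_syzygies), and the same remainder
    argument shows that they form a marked system over the variables x_i e_j
    (marked_system_syzygies), so the construction iterates.

    Constants.  Suppose that all heads are variables and that no matrix entry
    has a constant term.  In x_i f_j = sum_q c_q f_q compare the coefficients of
    the head x_l e_k of f_q.  Tails avoid heads, so the right side is the
    constant term of c_q, while the left side is 0 because f_j has no constant
    entry.  Hence the next matrix has no constant terms either
    (const_part_syzygies_step).  For the first matrix, a constant entry is by
    homogeneity a whole entry of a syzygy of F, so that F would not be minimal
    (minimal_generators_no_units).  This gives (i).

    For (ii), a minimal resolution G of M and the U-resolution H are compared by
    homogeneous chain maps in both directions.  A chain endomorphism lifting the
    identity is homotopic to it, hence is the identity modulo the variables in
    each degree where the two adjacent differentials vanish modulo the variables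
    (unitfree_endo).  So the maps G -> H -> G compose to the identity modulo the
    variables.  If G_k and H_k have the same rank, both maps are invertible
    there, which forces the differentials of H next to H_k to vanish modulo the
    variables (gens_unitfree).  By the argument on constants this persists in
    all higher degrees, where both composites are then the identity, so that the
    numbers of generators agree degree by degree (unitfree_gens).  When U is
    stable, its own Pommaret basis is a marked basis to which (i) applies, so its
    Betti numbers are the ranks of the U-resolution. *)

Local Notation span := Defs.span.
Local Notation head P j := (tnth (in_tuple P) j).

(** * A lexicographic order on monomials *)

Section Lex.
Variable n : nat.
Implicit Types a b c : 'X_{1..n}.

(** Variables with a larger index weigh more, whatever the total degree: passing
    to the cone that contains a term can raise the degree of the cofactor. *)
Definition mlex a b : Prop :=
  exists2 l : 'I_n, (a l < b l)%N & forall p : 'I_n, (l < p)%N -> a p = b p.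

Lemma mlex_irr a : ~ mlex a a.
Proof. by case=> l; rewrite ltnn. Qed.

Lemma mlex_trans a b c : mlex a b -> mlex b c -> mlex a c.
Proof.
move=> [l hl el] [k hk ek]; case: (ltngtP l k) => lk.
- exists k => [|p hp]; first by rewrite el.
  by rewrite el ?ek // (ltn_trans lk).
- exists l => [|p hp]; first by rewrite -ek.
  by rewrite el ?ek // (ltn_trans lk).
have e : l = k by apply: val_inj.
subst k; exists l => [|p hp]; first exact: ltn_trans hl hk.
by rewrite el ?ek.
Qed.

Lemma mlexD2l c a b : mlex a b -> mlex (c + a)%MM (c + b)%MM.
Proof.
move=> [l hl el]; exists l => [|p hp]; first by rewrite !mnmDE ltn_add2l.
by rewrite !mnmDE el.
Qed.

Lemma mlex_total a b : a != b -> mlex a b \/ mlex b a.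
Proof.
move=> neq_ab; have [i0 hi0] : exists i, a i != b i.
  apply/existsP; rewrite -negb_forall; apply: contra neq_ab => /forallP e.
  by apply/eqP/mnmP=> i; apply/eqP.
case: (@arg_maxnP _ i0 [pred i | a i != b i] (fun i : 'I_n => i : nat) hi0).
move=> l /= neq_l max_l.
have e (p : 'I_n) : (l < p)%N -> a p = b p.
  by rewrite ltnNge => lp; apply/eqP; apply: contraR lp => /max_l.
case: (ltngtP (a l) (b l)) neq_l => // hl _; [left|right]; exists l => // p hp.
by rewrite e.
Qed.

(** The order is a lexicographic product of finitely many copies of nat.  The
    induction is on the number k of low variables that may change: the
    property holds for all monomials that agree with a from x_k on, once it holds
    for those smaller than a because of some x_l with l at least k. *)
Lemma mlex_ind (Q : 'X_{1..n} -> Prop) :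
  (forall a, (forall b, mlex b a -> Q b) -> Q a) -> forall a, Q a.
Proof.
move=> H.
have main k a :
    (forall b (l : 'I_n), (k <= l)%N -> (b l < a l)%N ->
       (forall p : 'I_n, (l < p)%N -> b p = a p) -> Q b) ->
    forall a', (forall p : 'I_n, (k <= p)%N -> a' p = a p) -> Q a'.
  elim: k a => [|k IH] a Ha a' e.
    have -> : a' = a by apply/mnmP=> p; apply: e.
    by apply: H => b [l hl el]; apply: (Ha b l).
  case: (ltnP k n) => [kn|nk]; last first.
    apply: (IH a) => // [b l kl|p kp]; first by have := ltn_ord l; lia.
    by have := ltn_ord p; lia.
  have [u eu] := ubnP (a' (Ordinal kn)).
  elim: u => // u IHu in a' e eu *.
  apply: (IH a') => // b l kl hl el.
  case: (ltngtP k l) kl => // kl _.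
    apply: (Ha b l) => // [|p hp]; first by rewrite -e.
    by rewrite el // e //; apply: ltn_trans hp.
  have El : l = Ordinal kn by apply: val_inj.
  subst l; apply: IHu => [p hp|]; first by rewrite el // e.
  exact: leq_trans hl _.
move=> a; apply: (main n a) => // b l; have := ltn_ord l; lia.
Qed.

End Lex.

Lemma maximal_in (T : eqType) (r : T -> T -> Prop) (s : seq T) :
  (forall x, ~ r x x) -> (forall x y z, r x y -> r y z -> r x z) -> s != [::] ->
  exists2 x, x \in s & forall y, y \in s -> ~ r x y.
Proof.
move=> irr tr; elim: s => // x s IH _.
have [->|/IH[y ys ymax]] := eqVneq s [::].
  by exists x => [|y]; rewrite inE // => /eqP ->; apply: irr.
case: (classic (r y x)) => [ryx|nryx].
  exists x => [|z]; rewrite inE ?eqxx // => /predU1P[->|zs rxz]; first exact: irr.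
  exact: (ymax z zs (tr _ _ _ ryx rxz)).
exists y => [|z]; rewrite inE ?ys ?orbT // => /predU1P[->//|]; exact: ymax.
Qed.

Section Cones.
Variable n : nat.
Implicit Types a b c : 'X_{1..n.+1}.

Lemma minvar_lt a (p : 'I_n.+1) : (p < minvar a)%N -> a p = 0%N.
Proof.
by move/(before_find 0%N)/negbFE/eqP; rewrite (mnm_nth 0%N).
Qed.

Lemma cone_refl a : cone a a.
Proof. by exists 0%MM; rewrite ?add0m // => i _; rewrite mnm0E. Qed.

(** Where c and d last differ, c cannot be the larger one: there the variable is
    multiplicative for g, so g has no variable below it, and g would divide e with
    a multiplicative cofactor. *)
Lemma cone_mlex (c d g e : 'X_{1..n.+1}) :
  ~ cone g e -> (forall i, nonmult g i -> c i = 0%N) -> (d + e = c + g)%MM ->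
  mlex c d.
Proof.
move=> ncone mult E.
have [ecd|/mlex_total[//|[l hl el]]] := eqVneq c d.
  by case: ncone; move: E; rewrite ecd => /addmI ->; apply: cone_refl.
have Ep p : (d p + e p = c p + g p)%N by rewrite -!mnmDE E.
have lg : (l <= minvar g)%N.
  by rewrite leqNgt; apply/negP => /mult; move: hl; case: (c l).
have ge p : (g p <= e p)%N.
  case: (ltngtP p l) => [pl|lp|/val_inj ->].
  - by rewrite minvar_lt // (leq_trans pl).
  - by have := Ep p; rewrite el //; lia.
  - by have := Ep l; lia.
case: ncone; exists (e - g)%MM; last by rewrite submK //; apply/mnm_lepP.
move=> i gi; rewrite mnmBE; have := Ep i; rewrite el ?(leq_ltn_trans lg) //; lia.
Qed.

Lemma minvarU (i : 'I_n.+1) : minvar U_(i)%MM = i.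
Proof.
apply/eqP; rewrite eqn_leq leqNgt; apply/andP; split.
  by apply/negP => /minvar_lt; rewrite mnm1E eqxx.
rewrite leqNgt; apply/negP => lt.
have lt' : (minvar U_(i)%MM < n.+1)%N := ltn_trans lt (ltn_ord i).
have := @nth_find _ 0%N (fun e => e != 0%N) (multinom_val U_(i)%MM).
rewrite has_find size_tuple => /(_ lt').
rewrite -/(minvar _) -[nth _ _ _](mnm_nth 0%N U_(i)%MM (Ordinal lt')) mnm1E.
by rewrite /= eqb0 negbK => /eqP E; move: lt; rewrite {2}E /= ltnn.
Qed.

Lemma coneU (i : 'I_n.+1) b :
  cone U_(i)%MM b <-> (0 < b i)%N /\ forall p : 'I_n.+1, (i < p)%N -> b p = 0%N.
Proof.
split=> [[c mult ->]|[bi bp]].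
  split=> [|p ip]; first by rewrite mnmDE mnm1E eqxx addn1.
  rewrite mnmDE mnm1E mult; last by rewrite /nonmult minvarU.
  by case: eqP => // e; move: ip; rewrite e ltnn.
exists (b - U_(i))%MM; last first.
  rewrite submK //; apply/mnm_lepP => p; rewrite mnm1E.
  by case: eqP => // <-.
by move=> p; rewrite /nonmult minvarU => ip; rewrite mnmBE bp.
Qed.

End Cones.

(** * Coefficients and homogeneous parts of polynomial vectors *)

Section Coefficients.
Variables (K : fieldType) (n : nat).
Local Notation R := {mpoly K[n.+1]}.
Variable m : nat.
Implicit Types (v w : 'cV[R]_m) (t u : term n m) (b : 'X_{1..n.+1}).

Lemma vcoef0 t : coef (0 : 'cV[R]_m) t = 0.
Proof. by rewrite /coef mxE mcoeff0. Qed.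

Lemma vcoefD v w t : coef (v + w) t = coef v t + coef w t.
Proof. by rewrite /coef mxE mcoeffD. Qed.

Lemma vcoefN v t : coef (- v) t = - coef v t.
Proof. by rewrite /coef mxE mcoeffN. Qed.

Lemma vcoefB v w t : coef (v - w) t = coef v t - coef w t.
Proof. by rewrite vcoefD vcoefN. Qed.

Lemma vcoefC (x : K) v t : coef (x%:MP *: v) t = x * coef v t.
Proof. by rewrite /coef mxE mcoeffCM. Qed.

Lemma coef_tvec t u : coef (tvec K t) u = (t == u)%:R.
Proof.
case: t u => [b k] [c l]; rewrite /coef !mxE /= andbT.
rewrite -pair_eqE /= /pair_eq /= (eq_sym k l).
case: eqP => _; last by rewrite mulr0 mcoeff0 andbF.
by rewrite mulr1 mcoeffX andbT.
Qed.

Lemma vcoefX b v t : coef ('X_[b] *: v) ((b + t.1)%MM, t.2) = coef v t.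
Proof. by rewrite /coef mxE mulrC mcoeffMX. Qed.

Lemma vcoefX_neq0 b v t : coef ('X_[b] *: v) t != 0 ->
  exists2 u, coef v u != 0 & t = ((b + u.1)%MM, u.2).
Proof.
case: t => [c k]; rewrite /coef mxE /= mulrC -mcoeff_msupp.
rewrite (perm_mem (msuppMX _ _)) => /mapP[c' hc ->].
by exists (c', k); rewrite //= -mcoeff_msupp.
Qed.

Lemma tvecM b t : 'X_[b] *: tvec K t = tvec K ((b + t.1)%MM, t.2).
Proof. by rewrite /tvec scalerA -mpolyXD. Qed.

Lemma coef_inj v w : (forall t, coef v t = coef w t) -> v = w.
Proof.
move=> e; apply/colP => k; apply/mpolyP => b; exact: (e (b, k)).
Qed.

Lemma vec_terms v :
  v = \sum_k \sum_(b <- msupp (v k 0)) (coef v (b, k))%:MP *: tvec K (b, k).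
Proof.
apply/colP => i; rewrite !summxE (bigD1 i) //= [X in _ + X]big1 ?addr0 => [|k ki].
  rewrite !summxE {1}[v i 0]mpolyE; apply: eq_bigr => b _.
  by rewrite !mxE !eqxx mulr1 mul_mpolyC.
rewrite summxE big1 // => b _; rewrite !mxE /= eq_sym (negbTE ki).
by rewrite !mulr0.
Qed.

(** A vector is a sum of constant multiples of the terms of its own support; an
    additive property is therefore checked on those only. *)
Lemma vec_ind v (Q : 'cV[R]_m -> Prop) :
  Q 0 -> (forall w1 w2, Q w1 -> Q w2 -> Q (w1 + w2)) ->
  (forall t, coef v t != 0 -> Q ((coef v t)%:MP *: tvec K t)) -> Q v.
Proof.
move=> Q0 QD Qt; rewrite [v]vec_terms.
apply: big_ind => // k _; rewrite big_seq.
by apply: big_ind => // b hb; apply: Qt; rewrite /coef /= -mcoeff_msupp.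
Qed.

Section HPart.
Variable d : 'I_m -> int.

Definition hpart (s : int) v : 'cV[R]_m :=
  \col_k \sum_(b <- msupp (v k 0) | term_deg d (b, k) == s)
    (v k 0)@_b *: 'X_[b].

Lemma coef_hpart s v t :
  coef (hpart s v) t = if term_deg d t == s then coef v t else 0.
Proof.
case: t => [b k]; rewrite /coef mxE /= raddf_sum /=.
case: (boolP (b \in msupp (v k 0))) => [hb|hb]; last first.
  rewrite (memN_msupp_eq0 hb) if_same big_seq_cond big1 // => c /andP[hc _].
  rewrite mcoeffZ mcoeffX; case: eqP hb => [<-|_ _]; first by rewrite hc.
  by rewrite mulr0.
rewrite big_mkcond /= (bigD1_seq b) //= big1 ?addr0 => [|c cb].
  by case: ifP; rewrite // mcoeffZ mcoeffX eqxx mulr1.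
by case: ifP; rewrite // mcoeffZ mcoeffX (negbTE cb) mulr0.
Qed.

Lemma hpart_homogeneous s v : is_homogeneous d s (hpart s v).
Proof.
move=> t; rewrite coef_hpart; case: (eqVneq (term_deg d t) s) => // _.
by rewrite eqxx.
Qed.

Lemma hpart_id s v : is_homogeneous d s v -> hpart s v = v.
Proof.
move=> hv; apply: coef_inj => t; rewrite coef_hpart; case: eqP => // ht.
by case: (eqVneq (coef v t) 0) => // /hv.
Qed.

Lemma hpart_homog s s' v :
  is_homogeneous d s' v -> hpart s v = if s' == s then v else 0.
Proof.
move=> hv; case: eqP => [<-|ne]; first exact: hpart_id.
apply: coef_inj => t; rewrite coef_hpart vcoef0; case: eqP => // ht.
by case: (eqVneq (coef v t) 0) => // /hv e; case: ne; rewrite -e.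
Qed.

Lemma hpartD s v w : hpart s (v + w) = hpart s v + hpart s w.
Proof.
by apply: coef_inj => t; rewrite vcoefD !coef_hpart vcoefD; case: ifP; rewrite ?addr0.
Qed.

Lemma hpartC s (x : K) v : hpart s (x%:MP *: v) = x%:MP *: hpart s v.
Proof.
by apply: coef_inj => t; rewrite vcoefC !coef_hpart vcoefC; case: ifP; rewrite ?mulr0.
Qed.

Lemma hpart0 s : hpart s 0 = 0.
Proof. by apply: coef_inj => t; rewrite coef_hpart vcoef0 if_same. Qed.

Lemma hpart_eq0 v : (forall s, hpart s v = 0) -> v = 0.
Proof.
move=> hv; apply: coef_inj => t.
by have := coef_hpart (term_deg d t) v t; rewrite eqxx hv.
Qed.

Lemma homogX s b v :
  is_homogeneous d s v -> is_homogeneous d ((mdeg b)%:Z + s) ('X_[b] *: v).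
Proof.
move=> hv t /vcoefX_neq0[u /hv <- ->].
by rewrite /term_deg /= mdegD PoszD addrA.
Qed.

Lemma homogB s v w :
  is_homogeneous d s v -> is_homogeneous d s w -> is_homogeneous d s (v - w).
Proof.
move=> hv hw t; rewrite vcoefB.
case: (eqVneq (coef v t) 0) => [->|/hv //].
by rewrite sub0r oppr_eq0 => /hw.
Qed.

Lemma homog_tvec t : is_homogeneous d (term_deg d t) (tvec K t).
Proof.
by move=> u; rewrite coef_tvec; case: (eqVneq t u) => [->|]; rewrite ?eqxx.
Qed.

End HPart.
End Coefficients.

Section HomogeneousMatrices.
Variables (K : fieldType) (n : nat).
Local Notation R := {mpoly K[n.+1]}.
Variables (m p : nat) (d : 'I_m -> int) (e : 'I_p -> int) (A : 'M[R]_(m, p)).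

Lemma mulmx_tvec t : A *m tvec K t = 'X_[t.1] *: col t.2 A.
Proof. by rewrite /tvec -scalemxAr -colE. Qed.

Definition homog_cols := forall j, is_homogeneous d (e j) (col j A).

Hypothesis hA : homog_cols.

(** A matrix with homogeneous columns is a graded map, so it commutes with taking
    homogeneous parts. *)
Lemma hpart_mulmx s (c : 'cV[R]_p) : hpart d s (A *m c) = A *m hpart e s c.
Proof.
apply: (@vec_ind _ _ _ c (fun c => hpart d s (A *m c) = A *m hpart e s c))
  => [|u w Hu Hw|t _].
- by rewrite hpart0 !mulmx0 hpart0.
- by rewrite hpartD !mulmxDr hpartD Hu Hw.
rewrite hpartC -[in LHS]scalemxAr -[in RHS]scalemxAr hpartC; congr (_ *: _).
rewrite (hpart_homog _ (@homog_tvec K _ _ e t)) mulmx_tvec.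
rewrite (hpart_homog _ (homogX (hA (j := t.2)))) /term_deg.
by case: ifP; rewrite ?mulmx0 ?mulmx_tvec.
Qed.

Lemma homog_mulmx s (c : 'cV[R]_p) :
  is_homogeneous e s c -> is_homogeneous d s (A *m c).
Proof. by move=> hc; rewrite -(hpart_id hc) -hpart_mulmx; apply: hpart_homogeneous. Qed.

Lemma homog_preimage s v : is_homogeneous d s v -> span A v ->
  exists2 c, is_homogeneous e s c & v = A *m c.
Proof.
move=> hv [c E]; exists (hpart e s c); first exact: hpart_homogeneous.
by rewrite -hpart_mulmx -E hpart_id.
Qed.

End HomogeneousMatrices.

(** * Division by a marked system and its syzygies *)

(** Unlike injection, this does not unfold the monomials into sequences. *)
Lemma pair_inj (S T : Type) (a b : S) (k l : T) : (a, k) = (b, l) -> a = b /\ k = l.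
Proof. by case. Qed.

Section MarkedSystems.
Variables (K : fieldType) (n : nat).
Local Notation R := {mpoly K[n.+1]}.

Section Definitions.
Variable m : nat.
Implicit Types (P : seq (term n m)).

(** For a Pommaret basis P of U, the condition that the support avoids U; stated
    through the cones alone, it makes sense at every stage of the resolution. *)
Definition reduced P (v : 'cV[R]_m) : Prop :=
  forall t, coef v t != 0 -> forall p, p \in P -> ~ term_cone p t.

Definition multiplicative_for P (t : term n (size P)) : Prop :=
  forall i, nonmult (head P t.2).1 i -> t.1 i = 0%N.

Definition multiplicative P (c : 'cV[R]_(size P)) : Prop :=
  forall t, coef c t != 0 -> multiplicative_for t.

(** The properties of a marked basis that are inherited by its fundamental
    syzygies.  The sum decomposition of the degree s part is replaced by its
    directness alone, in all degrees at once; existence of the decomposition is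
    recovered by division. *)
Record marked_system (d : 'I_m -> int) P (F : 'M[R]_(m, size P)) : Prop := {
  ms_uniq : uniq P;
  ms_disjoint : forall p q t, p \in P -> q \in P ->
    term_cone p t -> term_cone q t -> p = q;
  ms_homogeneous : homog_cols d (fun j => term_deg d (head P j)) F;
  ms_head : forall j, coef (col j F) (head P j) = 1;
  ms_tail : forall j, reduced P (col j F - tvec K (head P j));
  ms_direct : forall v, span F v -> reduced P v -> v = 0
}.

End Definitions.

Section Closure.
Variables (m : nat) (P : seq (term n m)).

Lemma mem_heads j : head P j \in P.
Proof. exact: mem_tnth. Qed.

Lemma vcoefD_neq0 p (v w : 'cV[R]_p) t :
  coef (v + w) t != 0 -> coef v t != 0 \/ coef w t != 0.
Proof.
rewrite vcoefD; have [->|] := eqVneq (coef v t) 0; last by left.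
by rewrite add0r; right.
Qed.

Lemma vcoefC_neq0 p x (v : 'cV[R]_p) t : coef (x%:MP *: v) t != 0 -> coef v t != 0.
Proof. by rewrite vcoefC mulf_eq0 negb_or => /andP[]. Qed.

Lemma coef_tvec_neq0 p (t u : term n p) : coef (tvec K t) u != 0 -> u = t.
Proof. by rewrite coef_tvec; case: (eqVneq t u) => [->|]; rewrite ?eqxx. Qed.

Lemma span0 p q (A : 'M[R]_(p, q)) : span A 0.
Proof. by exists 0; rewrite mulmx0. Qed.

Lemma spanD p q (A : 'M[R]_(p, q)) v w : span A v -> span A w -> span A (v + w).
Proof. by move=> [c ->] [c' ->]; exists (c + c'); rewrite mulmxDr. Qed.

Lemma spanZ p q (A : 'M[R]_(p, q)) x v : span A v -> span A (x *: v).
Proof. by move=> [c ->]; exists (x *: c); rewrite scalemxAr. Qed.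

Lemma span_col p q (A : 'M[R]_(p, q)) j : span A (col j A).
Proof. by exists (delta_mx j 0); rewrite colE. Qed.

Lemma reduced0 : reduced P 0.
Proof. by move=> t; rewrite vcoef0 eqxx. Qed.

Lemma reducedD v w : reduced P v -> reduced P w -> reduced P (v + w).
Proof. by move=> hv hw t /vcoefD_neq0[/hv|/hw]. Qed.

Lemma multiplicative0 : multiplicative (0 : 'cV[R]_(size P)).
Proof. by move=> t; rewrite vcoef0 eqxx. Qed.

Lemma multiplicativeD (v w : 'cV[R]_(size P)) :
  multiplicative v -> multiplicative w -> multiplicative (v + w).
Proof. by move=> hv hw t /vcoefD_neq0[/hv|/hw]. Qed.

Lemma multiplicativeC x (v : 'cV[R]_(size P)) :
  multiplicative v -> multiplicative (x%:MP *: v).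
Proof. by move=> hv t /vcoefC_neq0/hv. Qed.

Lemma writingE F v (c : 'cV[R]_(size P)) :
  pommaret_writing F v c <-> v = F *m c /\ multiplicative c.
Proof.
split=> -[-> hc]; split=> //; [move=> [b j] hb i hi|move=> j a b hb].
  have [] := hc j b; first by rewrite mcoeff_msupp.
  by move=> c' hc' /addIm ->; apply: hc'.
exists b => // i; apply: (hc (b, j)); by rewrite /coef /= -mcoeff_msupp.
Qed.

Lemma syz_headsP h : reflect
  (exists j i, nonmult (head P j).1 i /\ h = (U_(i)%MM, j)) (h \in syz_heads P).
Proof.
apply: (iffP flatten_mapP) => [[j _ /mapP[i]]|[j [i [hi ->]]]].
  by rewrite mem_filter => /andP[hi _] ->; exists j, i.
by exists j; rewrite ?mem_enum //; apply: map_f; rewrite mem_filter hi mem_enum.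
Qed.

Lemma uniq_syz_heads : uniq (syz_heads P).
Proof.
apply: (@allpairs_uniq_dep _ (fun=> 'I_n.+1) _ (fun j i => (U_(i)%MM, j))
  (enum 'I_(size P)) (fun j => [seq i <- enum 'I_n.+1 | nonmult (head P j).1 i])).
- exact: enum_uniq.
- by move=> j _; exact/filter_uniq/enum_uniq.
move=> [j i] [j' i'] _ _ e; have /= -> : j = j' := congr1 snd e.
move: (congr1 fst e) => /= /mnmP/(_ i').
by rewrite !mnm1E eqxx; case: (eqVneq i i') => [->|].
Qed.

(** The cone of x_i is the set of monomials whose largest variable is x_i.  Since
    the non-multiplicative variables for a head form a final segment, a monomial
    with some non-multiplicative variable has its largest variable among them. *)
Lemma reduced_syz_heads (c : 'cV[R]_(size P)) :
  reduced (syz_heads P) c <-> multiplicative c.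
Proof.
split=> hc t ht; last first.
  move=> p /syz_headsP[j [i [hi ->]]] [/= /coneU[ti _] e].
  by rewrite (hc t ht i) ?e in ti.
move=> i hi; case: (posnP (t.1 i)) => // ti.
case: (@arg_maxnP _ i [pred l | 0 < t.1 l]%N (fun l : 'I_n.+1 => l : nat) ti).
move=> l /= tl lmax.
have hl : nonmult (head P t.2).1 l by apply: leq_trans hi (lmax i ti).
case: (hc t ht (U_(l)%MM, t.2)); first by apply/syz_headsP; exists t.2, l.
split=> //=; apply/coneU; split=> // q lq.
by case: (posnP (t.1 q)) => // /lmax; rewrite leqNgt lq.
Qed.

Lemma syz_heads_disjoint p q t : p \in syz_heads P -> q \in syz_heads P ->
  term_cone p t -> term_cone q t -> p = q.
Proof.
move=> /syz_headsP[j [i [_ ->]]] /syz_headsP[k [l [_ ->]]].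
move=> [/= /coneU[ti ei] <-] [/= /coneU[tl el] <-]; congr (U_(_)%MM, _).
case: (ltngtP i l) => [/ei e|/el e|/val_inj //].
  by rewrite e in tl.
by rewrite e in ti.
Qed.

End Closure.

Section Reduction.
Variables (m : nat) (d : 'I_m -> int) (P : seq (term n m)) (F : 'M[R]_(m, size P)).
Hypothesis HF : marked_system d F.

Lemma head_inj : injective (fun j => head P j).
Proof. by apply/tuple_uniqP; rewrite in_tupleE; exact: ms_uniq HF. Qed.

Lemma cone_head (t : term n (size P)) : multiplicative_for t ->
  term_cone (head P t.2) ((t.1 + (head P t.2).1)%MM, (head P t.2).2).
Proof. by move=> ht; split=> //=; exists t.1. Qed.

Lemma supp_col j t : coef (col j F) t != 0 ->
  t = head P j \/ forall p, p \in P -> ~ term_cone p t.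
Proof.
move=> ht; case: (eqVneq (head P j) t) => [->|ne]; [by left|right].
apply: (ms_tail HF (j := j)).
by rewrite vcoefB coef_tvec (negbTE ne) subr0.
Qed.

(** Subtracting from a term in a cone the corresponding multiple of the marked
    element leaves multiples of tail terms.  The tail terms lie in no cone, so by
    cone_mlex the cofactors met afterwards are smaller, and induction applies. *)
Lemma cone_division (a : 'X_{1..n.+1}) v :
  (forall t, coef v t != 0 -> forall u : term n (size P), multiplicative_for u ->
     t = ((u.1 + (head P u.2).1)%MM, (head P u.2).2) -> mlex u.1 a) ->
  exists c g, [/\ v = F *m c + g, multiplicative c, reduced P g &
                  forall t, coef c t != 0 -> mlex t.1 a].
Proof.
elim/mlex_ind: a v => a IH v hv.
apply: (@vec_ind _ _ _ v (fun w => exists c g, [/\ w = F *m c + g,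
    multiplicative c, reduced P g & forall t, coef c t != 0 -> mlex t.1 a]))
  => [|v1 v2|t ht].
- exists 0, 0; split; rewrite ?mulmx0 ?addr0 //; try exact: multiplicative0.
    exact: reduced0.
  by move=> t; rewrite vcoef0 eqxx.
- move=> [c1 [g1 [-> mc1 rg1 lc1]]] [c2 [g2 [-> mc2 rg2 lc2]]].
  exists (c1 + c2), (g1 + g2); split.
  + by rewrite mulmxDr addrACA.
  + exact: multiplicativeD.
  + exact: reducedD.
  + by move=> t /vcoefD_neq0[/lc1|/lc2].
set x := coef v t.
case: (classic (forall p, p \in P -> ~ term_cone p t)) => [red|nred].
  exists 0, (x%:MP *: tvec K t); split; rewrite ?mulmx0 ?add0r //.
  + exact: multiplicative0.
  + by move=> u /vcoefC_neq0/coef_tvec_neq0 ->.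
  + by move=> u; rewrite vcoef0 eqxx.
have [u mu tE] : exists2 u : term n (size P), multiplicative_for u &
    t = ((u.1 + (head P u.2).1)%MM, (head P u.2).2).
  apply: NNPP => no; apply: nred => p /(tnthP (in_tuple P))[j ->] [[b hb e1] e2].
  by apply: no; exists (b, j) => //=; rewrite -e1 -e2 -surjective_pairing.
have lu : mlex u.1 a by apply: hv ht u mu tE.
pose tail := col u.2 F - tvec K (head P u.2).
have [|c [g [E mc rg lc]]] := IH _ lu (- x%:MP *: ('X_[u.1] *: tail)).
  move=> w; rewrite -mpolyCN => /vcoefC_neq0/vcoefX_neq0[y hy ->] z mz e.
  have [e1 e2] := pair_inj e.
  apply: cone_mlex e1; last exact: mz.
  move=> yz; apply: (ms_tail HF hy (p := head P z.2)); first exact: mem_tnth.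
  by split.
exists (x%:MP *: tvec K u + c), g; split=> //.
- rewrite mulmxDr -scalemxAr mulmx_tvec -addrA -E /tail.
  rewrite scaleNr -scalerBr -scalerBr opprB addrCA subrr addr0.
  by rewrite tvecM -tE.
- apply: multiplicativeD mc => w /vcoefC_neq0/coef_tvec_neq0 ->; exact: mu.
- move=> w /vcoefD_neq0[/vcoefC_neq0/coef_tvec_neq0 -> //|/lc hw].
  exact: mlex_trans hw lu.
Qed.

(** Let x be a term of c with lex-maximal cofactor.  The head of its column gives
    a term u of F c that nothing cancels: other heads are in other cones, and a
    tail term reaching u would need a larger cofactor, by cone_mlex. *)
Lemma writing_unique (c : 'cV[R]_(size P)) :
  multiplicative c -> F *m c = 0 -> c = 0.
Proof.
move=> mc Fc; apply: NNPP => c0.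
pose s := [seq (b, j) | j <- enum 'I_(size P), b <- msupp (c j 0)].
have sP t : reflect (coef c t != 0) (t \in s).
  apply: (iffP allpairsPdep) => [[j [b [_ + ->]]]|ht].
    by rewrite mcoeff_msupp.
  by exists t.2, t.1; rewrite mem_enum mcoeff_msupp -surjective_pairing; split.
have [x /sP xs xmax] : exists2 x, x \in s & forall y, y \in s -> ~ mlex x.1 y.1.
  apply: (@maximal_in _ (fun x y => mlex x.1 y.1)) => [x|x y z|].
  - exact: mlex_irr.
  - exact: mlex_trans.
  apply/eqP => s0; apply: c0; apply: coef_inj => t; rewrite vcoef0.
  by apply/eqP; case: eqP => // /eqP/sP; rewrite s0.
have mx := mc _ xs.
pose u : term n m := ((x.1 + (head P x.2).1)%MM, (head P x.2).2).
suff E : coef (F *m c) u = coef c x by move: xs; rewrite -E Fc vcoef0 eqxx.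
apply: (@vec_ind _ _ _ c (fun w => coef (F *m w) u = coef w x)) => [|v w hv hw|t ht].
- by rewrite mulmx0 !vcoef0.
- by rewrite mulmxDr !vcoefD hv hw.
rewrite -scalemxAr !vcoefC mulmx_tvec coef_tvec; congr (_ * _).
case: (eqVneq t x) => [->|tx]; first by rewrite vcoefX (ms_head HF).
apply/eqP; apply: contraNT tx => /vcoefX_neq0[y hy e]; have [e1 e2] := pair_inj e.
have [ey|ny] := supp_col hy.
  subst y; have ej : t.2 = x.2.
    apply: head_inj; apply: (ms_disjoint HF (t := u)); rewrite ?mem_tnth //.
      by rewrite e; apply/cone_head/mc.
    exact: cone_head.
  move: e1; rewrite ej => /addIm e1.
  by rewrite (surjective_pairing t) (surjective_pairing x) ej e1.
case: (xmax t); first exact/sP.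
apply: (@cone_mlex _ _ _ (head P x.2).1 y.1) => // yx.
by apply: (ny (head P x.2)); [exact: mem_tnth|split].
Qed.

(** The bound on cofactors is what makes rewriting by fundamental syzygies
    terminate.  It holds for the head too, because a non-multiplicative multiple
    of a head leaves the cone of that head. *)
Lemma fund_writing j i : nonmult (head P j).1 i ->
  let c := writing F ('X_[U_(i)] *: col j F) in
  [/\ 'X_[U_(i)] *: col j F = F *m c, multiplicative c
    & forall t, coef c t != 0 -> mlex t.1 U_(i)%MM].
Proof.
move=> hi; set v := 'X_[_] *: _.
have [|c [g [E mc rg lc]]] := @cone_division U_(i)%MM v.
  move=> t /vcoefX_neq0[y hy ->] u mu e; have [e1 e2] := pair_inj e.
  apply: (cone_mlex _ mu e1).
  have [ey|ny] := supp_col hy; last first.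
    by move=> yu; apply: (ny (head P u.2)); [exact: mem_tnth|split].
  subst y => ju; have ej : j = u.2.
    apply: head_inj; apply: (ms_disjoint HF (t := head P j)); rewrite ?mem_tnth //.
      by split=> //; apply: cone_refl.
  subst j; move: e1 => /addIm e1; have := mu i hi.
  by rewrite -e1 mnm1E eqxx.
have g0 : g = 0.
  apply: (ms_direct HF) => //; exists ('X_[U_(i)] *: delta_mx j 0 - c).
  by rewrite mulmxBr -scalemxAr -colE -/v E addrC addKr.
have W : pommaret_writing F v c by apply/writingE; rewrite E g0 addr0.
have /writingE[E' mc'] : pommaret_writing F v (writing F v).
  exact: epsilon_spec (ex_intro _ c W).
suff -> : writing F v = c by split=> //; rewrite E g0 addr0.
apply/eqP; rewrite -subr_eq0; apply/eqP; apply: writing_unique.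
  apply: multiplicativeD => //; rewrite -scaleN1r -mpolyC1 -mpolyCN.
  exact: multiplicativeC.
by rewrite mulmxBr -E' E g0 addr0 subrr.
Qed.

Lemma col_fund_syzygies (a : 'I_(size (syz_heads P))) :
  exists j i, [/\ nonmult (head P j).1 i, head (syz_heads P) a = (U_(i)%MM, j)
    & col a (fund_syzygies F) = tvec K (U_(i)%MM, j)
        - writing F ('X_[U_(i)] *: col j F)].
Proof.
have /syz_headsP[j [i [hi ha]]] := mem_heads a.
exists j, i; split=> //; rewrite -[RHS]/(fund_syz F (U_(i)%MM, j)) -ha.
by apply/colP => k; rewrite !mxE.
Qed.

Lemma fund_syz_col j i : nonmult (head P j).1 i ->
  exists a, col a (fund_syzygies F) = tvec K (U_(i)%MM, j)
    - writing F ('X_[U_(i)] *: col j F).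
Proof.
move=> hi; have /(tnthP (in_tuple (syz_heads P)))[a ha] :
    (U_(i)%MM, j) \in syz_heads P by apply/syz_headsP; exists j, i.
exists a; rewrite -[RHS]/(fund_syz F (U_(i)%MM, j)) ha.
by apply/colP => k; rewrite !mxE.
Qed.

Lemma mulmx_fund_syzygies : F *m fund_syzygies F = 0.
Proof.
apply/matrixP => k a; have [j [i [hi _ E]]] := col_fund_syzygies a.
have [EF _ _] := fund_writing hi.
have -> : (F *m fund_syzygies F) k a = (F *m col a (fund_syzygies F)) k 0.
  by rewrite colE mulmxA -colE [RHS]mxE.
by rewrite E mulmxBr -EF mulmx_tvec subrr !mxE.
Qed.

(** A non-multiplicative x_i in x^a e_j is traded, through the fundamental syzygy
    of (i, j), for cofactors smaller than x_i: a decreases in the lex order. *)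
Lemma multiplicative_mod_syzygies (w : 'cV[R]_(size P)) :
  exists2 c, multiplicative c & span (fund_syzygies F) (w - c).
Proof.
pose Q w := exists2 c : 'cV[R]_(size P),
  multiplicative c & span (fund_syzygies F) (w - c).
have Q0 : Q 0 by exists 0; [exact: multiplicative0|rewrite subrr; exact: span0].
have QD w1 w2 : Q w1 -> Q w2 -> Q (w1 + w2).
  move=> [c1 m1 s1] [c2 m2 s2]; exists (c1 + c2); first exact: multiplicativeD.
  by rewrite opprD addrACA; apply: spanD.
have QC x w0 : Q w0 -> Q (x%:MP *: w0).
  move=> [c mc sc]; exists (x%:MP *: c); first exact: multiplicativeC.
  by rewrite -scalerBr; apply: spanZ.
suff Qt a j : Q (tvec K (a, j)).
  by apply: (@vec_ind _ _ _ w Q) => // -[a j] _; apply: QC.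
elim/mlex_ind: a j => a IH j.
case: (classic (multiplicative_for (P := P) (a, j))) => [ma|nma].
  exists (tvec K (a, j)) => [t /coef_tvec_neq0 -> //|].
  by rewrite subrr; exact: span0.
have [i hi ai] : exists2 i, nonmult (head P j).1 i & a i != 0%N.
  apply: NNPP => no; apply: nma => i hi; apply/eqP; apply: contra_notT no.
  by move=> ai; exists i.
have [_ _ lc] := fund_writing hi; have [b Eb] := fund_syz_col hi.
move: lc Eb; set c := writing _ _ => lc Eb.
have Ea : (a - U_(i) + U_(i))%MM = a.
  by apply: submK; apply/mnm_lepP => p; rewrite mnm1E; case: eqP => // <-; rewrite lt0n.
set a0 := (a - U_(i))%MM in Ea.
have -> : tvec K (a, j) = 'X_[a0] *: col b (fund_syzygies F) + 'X_[a0] *: c.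
  by rewrite Eb -scalerDr subrK tvecM Ea.
apply: (QD).
  exists 0; first exact: multiplicative0.
  by rewrite subr0; apply/spanZ/span_col.
apply: (@vec_ind _ _ _ ('X_[a0] *: c) Q) => // t /vcoefX_neq0[u hu ->].
by apply/QC/IH; rewrite -Ea; apply/mlexD2l/lc.
Qed.

(** The remainder of a syzygy modulo the fundamental ones is a multiplicative
    syzygy, hence 0 by uniqueness of writings. *)
Lemma ker_fund_syzygies v : F *m v = 0 <-> span (fund_syzygies F) v.
Proof.
split=> [Fv|[c ->]]; last by rewrite mulmxA mulmx_fund_syzygies mul0mx.
have [c mc [b E]] := multiplicative_mod_syzygies v.
have c0 : c = 0.
  apply: writing_unique => //.
  have -> : c = v - fund_syzygies F *m b by rewrite -E opprB addrC subrK.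
  by rewrite mulmxBr Fv mulmxA mulmx_fund_syzygies mul0mx subrr.
by exists b; rewrite -E c0 subr0.
Qed.

(** Tails are writings, hence multiplicative, which means reduced for the new
    heads; homogeneity holds because the homogeneous part of a writing is again a
    writing of the same vector. *)
Lemma marked_system_syzygies :
  marked_system (fun j => term_deg d (head P j)) (fund_syzygies F).
Proof.
split.
- exact: uniq_syz_heads.
- exact: syz_heads_disjoint.
- move=> a; have [j [i [hi -> E]]] := col_fund_syzygies a; rewrite E.
  apply: homogB; first exact: homog_tvec.
  have [Ec mc _] := fund_writing hi.
  set c := writing _ _ in Ec mc *; set s := term_deg _ _.
  suff <- : hpart (fun j => term_deg d (head P j)) s c = c by exact: hpart_homogeneous.
  apply/eqP; rewrite -subr_eq0; apply/eqP; apply: writing_unique.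
    apply: multiplicativeD; last first.
      by rewrite -scaleN1r -mpolyC1 -mpolyCN; exact: multiplicativeC.
    move=> t; rewrite coef_hpart; case: ifP => _; last by rewrite eqxx.
    exact: mc.
  rewrite mulmxBr -(hpart_mulmx (ms_homogeneous HF)) -Ec hpart_id ?subrr //.
  exact/homogX/(ms_homogeneous HF).
- move=> a; have [j [i [hi -> E]]] := col_fund_syzygies a; rewrite E.
  have [_ mc _] := fund_writing hi; set c := writing _ _ in mc *.
  rewrite vcoefB coef_tvec eqxx; case: (eqVneq (coef c (U_(i)%MM, j)) 0).
    by move=> ->; rewrite subr0.
  by move/mc/(_ i hi) => /=; rewrite mnm1E eqxx.
- move=> a; have [j [i [hi -> E]]] := col_fund_syzygies a; rewrite E.
  have [_ mc _] := fund_writing hi; apply/reduced_syz_heads.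
  rewrite addrC addKr -scaleN1r -mpolyC1 -mpolyCN; exact: multiplicativeC.
- move=> v sv /reduced_syz_heads mv; apply: writing_unique => //.
  exact/ker_fund_syzygies.
Qed.

End Reduction.
End MarkedSystems.

(** * Constant parts, minimal generators and graded ranks *)

Section Constants.
Variables (K : fieldType) (n : nat).
Local Notation R := {mpoly K[n.+1]}.

(** The Leibniz rule for the derivative in x_l at the origin. *)
Lemma mcoeffU (l : 'I_n.+1) (x y : R) :
  (x * y)@_U_(l) = x@_U_(l) * y@_0%MM + x@_0%MM * y@_U_(l).
Proof.
have dE (z : R) : z@_U_(l) = (mderiv l z)@_0%MM.
  by rewrite mcoeff_deriv add0m mnm0E mulr1n.
by rewrite !dE mderivM mcoeffD !rmorphM.
Qed.

(** Reduction modulo the ideal of the variables, that is, tensoring with K. *)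
Definition const_part p q (A : 'M[R]_(p, q)) : 'M[K]_(p, q) :=
  map_mx (mcoeff 0%MM) A.

Variables (m : nat) (d : 'I_m -> int) (P : seq (term n m)).
Variables (F : 'M[R]_(m, size P)) (HF : marked_system d F).

(** When the heads are variables, the coefficients of linear terms detect the
    constant terms of a writing. *)
Lemma const_part_syzygies_step :
  (forall p, p \in P -> exists l, p.1 = U_(l)%MM) ->
  const_part F = 0 -> const_part (fund_syzygies F) = 0.
Proof.
move=> linear F0; have F00 k j : (F k j)@_0%MM = 0.
  by have /matrixP/(_ k j) := F0; rewrite !mxE.
apply/matrixP => q a; rewrite [RHS]mxE.
have [j [i [hi _ E]]] := col_fund_syzygies F a.
transitivity ((col a (fund_syzygies F) q 0)@_0%MM); first by rewrite !mxE.
have [Ec _ _] := fund_writing HF hi; rewrite E.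
set c := writing _ _ in Ec *.
have [l hl] := linear _ (mem_heads q).
set k := (head P q).2.
(* Compare the coefficients of the head x_l e_k of column q in x_i f_j = F c. *)
have c0 : (c q 0)@_0%MM = 0.
  have /(congr1 (mcoeff U_(l)%MM)) := congr1 (fun v : 'cV[R]_m => v k 0) Ec.
  rewrite !mxE mcoeffU F00 mulr0 mcoeffX mnm1_eq0 mul0r addr0.
  rewrite raddf_sum (bigD1 q) //= big1 ?addr0 => [|q' q'q].
    rewrite mcoeffU F00 mul0r addr0 => /esym.
    by have := ms_head HF q; rewrite /coef mxE hl => ->; rewrite mul1r.
  rewrite mcoeffU F00 mul0r addr0.
  suff -> : (F k q')@_U_(l) = 0 by rewrite mul0r.
  apply/eqP; apply: contraNT q'q => ne.
  have [|e|] := @supp_col _ _ _ _ _ _ HF q' (head P q).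
  - by rewrite /coef mxE hl.
  - by apply/eqP/(head_inj HF).
  - by move/(_ _ (mem_heads q)); case; split=> //; apply: cone_refl.
by rewrite !mxE mcoeffD mcoeffN c0 subr0 rmorphM /= mcoeffX mnm1_eq0 mul0r.
Qed.

End Constants.

Section ConstPart.
Variables (K : fieldType) (n : nat).
Local Notation R := {mpoly K[n.+1]}.

Lemma const_partM p q r (A : 'M[R]_(p, q)) (B : 'M[R]_(q, r)) :
  const_part (A *m B) = const_part A *m const_part B.
Proof. exact: map_mxM. Qed.

Lemma const_partD p q (A B : 'M[R]_(p, q)) :
  const_part (A + B) = const_part A + const_part B.
Proof. exact: map_mxD. Qed.

Lemma const_partB p q (A B : 'M[R]_(p, q)) :
  const_part (A - B) = const_part A - const_part B.
Proof. exact: map_mxB. Qed.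

Lemma const_part1 p : const_part (1%:M : 'M[R]_p) = 1%:M.
Proof. exact: map_mx1. Qed.

Lemma const_part_eq0 p q (A : 'M[R]_(p, q)) :
  const_part A = 0 <-> forall v a, ((A *m v) a (0 : 'I_1))@_0%MM = 0.
Proof.
split=> [A0 v a|A0].
  have : const_part (A *m v) = 0 by rewrite const_partM A0 mul0mx.
  by move/matrixP/(_ a 0); rewrite [LHS]mxE [RHS]mxE.
apply/matrixP => a b; rewrite [RHS]mxE -(A0 (delta_mx b 0) a) -colE.
by rewrite !mxE.
Qed.

Lemma homog_const_entry p (e : 'I_p -> int) s (v : 'cV[R]_p) a :
  is_homogeneous e s v -> (v a 0)@_0%MM != 0 ->
  e a = s /\ v a 0 = ((v a 0)@_0%MM)%:MP.
Proof.
move=> hv va; have es : e a = s.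
  by rewrite -(hv (0%MM, a)) // /term_deg /= mdeg0 add0r.
split=> //; apply/mpolyP => b; rewrite mcoeffC.
case: eqP => [->|b0]; first by rewrite mulr1.
rewrite mulr0; apply/eqP; apply: contra_notT b0 => /(hv (b, a)).
rewrite /term_deg /= es -[RHS]add0r => /addIr[] /eqP.
by rewrite mdeg_eq0 => /eqP.
Qed.

(** A unit coordinate of a homogeneous syzygy is a constant, so it lets one
    generator be expressed by the others. *)
Lemma minimal_generators_no_units m p (A : 'M[R]_(m, p))
    (M : 'cV[R]_m -> Prop) (e : 'I_p -> int) s v :
  minimal_generators A M -> is_homogeneous e s v -> A *m v = 0 ->
  forall a, (v a 0)@_0%MM = 0.
Proof.
move=> [gen min] hv Av a; apply/eqP; apply: contraT => va.
have [_ vaE] := homog_const_entry hv va; set x := (v a 0)@_0%MM in va vaE.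
suff /setP/(_ a) : ~: [set a] = [set: 'I_p] by rewrite !inE eqxx.
apply: min => w; split=> [/gen[c ->]|[c _ ->]]; last by apply/gen; exists c.
exists (c - (c a 0 * (x^-1)%:MP) *: v).
  move=> j; rewrite !inE negbK => /eqP ->.
  rewrite !mxE vaE -mulrA -mpolyCM mulVf // mpolyC1 mulr1 subrr //.
by rewrite mulmxBr -scalemxAr Av scaler0 subr0.
Qed.

(** If column j were redundant, some syzygy would have 1 as its coordinate j,
    whereas all coordinates of syzygies are in the ideal of the variables. *)
Lemma minimal_generators_of_const m p q (A : 'M[R]_(m, p)) (B : 'M[R]_(p, q))
    (M : 'cV[R]_m -> Prop) :
  generates A M -> (forall v, A *m v = 0 -> span B v) -> const_part B = 0 ->
  minimal_generators A M.
Proof.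
move=> gen exact_AB B0; split=> // J hJ; apply/setP => j; rewrite inE.
apply: contraT => jJ.
have /hJ[c cJ E] : M (col j A) by apply/gen; exists (delta_mx j 0); rewrite colE.
have [|b Eb] := exact_AB (delta_mx j 0 - c); first by rewrite mulmxBr -colE E subrr.
have /const_part_eq0/(_ b j) := B0; rewrite -Eb !mxE (cJ j) // !eqxx subr0 mcoeff1 eqxx.
by move/eqP; rewrite oner_eq0.
Qed.

End ConstPart.

Section GradedRank.
Variable K : fieldType.

(** The columns of A of degree j have their support in the rows of degree j, so
    the degree j blocks of A and B still compose to the identity. *)
Lemma graded_inverse_leq p q (dp : 'I_p -> int) (dq : 'I_q -> int)
    (A : 'M[K]_(p, q)) (B : 'M[K]_(q, p)) :
  (forall a b, A a b != 0 -> dp a = dq b) -> B *m A = 1%:M ->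
  forall j, (#|[set b | dq b == j]| <= #|[set a | dp a == j]|)%N.
Proof.
move=> gA BA j.
pose iq (b : 'I_#|[set b | dq b == j]|) := enum_val b.
pose ip (a : 'I_#|[set a | dp a == j]|) := enum_val a.
apply: (@mulmx1_min _ _ _ (mxsub iq ip B) (mxsub ip iq A)).
apply/matrixP => b c; rewrite !mxE.
have /matrixP/(_ (iq b) (iq c)) := BA; rewrite !mxE (inj_eq enum_val_inj) => <-.
rewrite [RHS](bigID (fun a => a \in [set a | dp a == j])) /= [X in _ = _ + X]big1 ?addr0.
  by rewrite [RHS]big_enum_val; apply: eq_bigr => a _; rewrite !mxE.
move=> a; rewrite inE => da; case: (eqVneq (A a (iq c)) 0) => [->|/gA e].
  by rewrite mulr0.
by case/negP: da; rewrite e; have := enum_valP c; rewrite inE.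
Qed.

Lemma eq_ranks_of_degree_counts p q (dp : 'I_p -> int) (dq : 'I_q -> int) :
  (forall j, #|[set a | dp a == j]| = #|[set b | dq b == j]|) -> p = q.
Proof.
move=> e.
have cE r (f : 'I_r -> int) j :
    #|[set a | f a == j]| = count_mem j [seq f a | a <- enum 'I_r].
  by rewrite cardsE cardE [LHS]size_filter count_map enumT.
have -> : p = size [seq dp a | a <- enum 'I_p] by rewrite size_map size_enum_ord.
have -> : q = size [seq dq a | a <- enum 'I_q] by rewrite size_map size_enum_ord.
by apply: perm_size; apply/allP => j _ /=; rewrite -!cE e.
Qed.

End GradedRank.

(** * Comparison of graded free resolutions *)

Lemma dependent_choice_seq (T : nat -> Type) (Q : forall i, T i -> Prop)
    (S : forall i, T i -> T i.+1 -> Prop) (x0 : T 0) :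
  Q 0 x0 -> (forall i x, Q i x -> exists y, Q i.+1 y /\ S i x y) ->
  exists f : forall i, T i, f 0 = x0 /\ forall i, Q i (f i) /\ S i (f i) (f i.+1).
Proof.
move=> Q0 step.
pose next i (x : {x : T i | Q i x}) :=
  constructive_indefinite_description _ (step i (sval x) (proj2_sig x)).
pose g := nat_rect (fun i => {x : T i | Q i x}) (exist _ x0 Q0)
  (fun i x => exist _ (sval (next i x)) (proj1 (proj2_sig (next i x)))).
exists (fun i => sval (g i)); split=> // i; split; first exact: proj2_sig.
exact: (proj2 (proj2_sig (next i (g i)))).
Qed.

Section Comparison.
Variables (K : fieldType) (n : nat).
Local Notation R := {mpoly K[n.+1]}.

Lemma choose_cols q r (Q : 'I_r -> 'cV[R]_q -> Prop) :
  (forall b, exists c, Q b c) -> exists X : 'M[R]_(q, r), forall b, Q b (col b X).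
Proof.
move=> H; pose f b := constructive_indefinite_description _ (H b).
exists (\matrix_(a, b) sval (f b) a 0) => b.
suff -> : col b (\matrix_(a, b) sval (f b) a 0) = sval (f b) by exact: proj2_sig.
by apply/colP => a; rewrite !mxE.
Qed.

Lemma col_mulmx p q r (A : 'M[R]_(p, q)) (B : 'M[R]_(q, r)) b :
  col b (A *m B) = A *m col b B.
Proof. by rewrite !colE mulmxA. Qed.

Lemma mulmx_cols p q r (A : 'M[R]_(p, q)) (X : 'M[R]_(q, r)) B :
  (forall b, col b B = A *m col b X) -> A *m X = B.
Proof.
move=> H; apply/matrixP => a b; have := congr1 (fun v : 'cV[R]_p => v a 0) (H b).
by rewrite -col_mulmx [LHS]mxE [RHS]mxE.
Qed.

Lemma factor p q r (A : 'M[R]_(p, q)) (B : 'M[R]_(p, r)) :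
  (forall b, span A (col b B)) -> exists X, A *m X = B.
Proof. by move/choose_cols => [X HX]; exists X; apply: mulmx_cols. Qed.

Lemma homog_factor p q r d e f (A : 'M[R]_(p, q)) (B : 'M[R]_(p, r)) :
  homog_cols d e A -> homog_cols d f B -> (forall b, span A (col b B)) ->
  exists X, A *m X = B /\ homog_cols e f X.
Proof.
move=> hA hB sAB.
have [|X HX] := @choose_cols q r
    (fun b c => is_homogeneous e (f b) c /\ col b B = A *m c).
  by move=> b; have [c hc E] := homog_preimage hA (hB b) (sAB b); exists c.
by exists X; split; [apply: mulmx_cols => b|move=> b]; case: (HX b).
Qed.

Variables (m : nat) (d : 'I_m -> int) (M : 'cV[R]_m -> Prop).
Implicit Types G H : free_complex K n m.

Definition degs G i (a : 'I_(rk G i)) : int := bdeg a.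

Record chain_map G H (phi : forall i, 'M[R]_(rk H i, rk G i)) : Prop := {
  cm_aug : aug H *m phi 0%N = aug G;
  cm_diff : forall i, diff H i *m phi i.+1 = phi i *m diff G i;
  cm_homog : forall i, homog_cols (@degs H i) (@degs G i) (phi i)
}.

Lemma diff_diff G i : graded_free_resolution d M G -> diff G i *m diff G i.+1 = 0.
Proof.
case=> _ _ _ _ ex; apply: mulmx_cols => b; symmetry.
by rewrite [RHS]col0; apply/ex/span_col.
Qed.

Lemma aug_diff G : graded_free_resolution d M G -> aug G *m diff G 0 = 0.
Proof.
case=> _ _ _ ex _; apply: mulmx_cols => b; symmetry.
by rewrite [RHS]col0; apply/ex/span_col.
Qed.

(** The usual lifting along exactness; homogeneous preimages exist by
    homog_preimage, so the lift can be chosen graded. *)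
Lemma chain_map_exists G H :
  graded_free_resolution d M G -> graded_free_resolution d M H ->
  exists phi, @chain_map G H phi.
Proof.
move=> rG rH; have [aG dG gG _ _] := rG; have [aH dH gH exH0 exH] := rH.
have [|phi0 [E0 h0]] := homog_factor aH aG.
  by move=> b; apply/gH/gG/span_col.
pose Q i (f : 'M[R]_(rk H i, rk G i)) :=
  homog_cols (@degs H i) (@degs G i) f /\
  forall b, span (diff H i) (f *m col b (diff G i)).
pose S i (f : 'M[R]_(rk H i, rk G i)) (g : 'M[R]_(rk H i.+1, rk G i.+1)) :=
  diff H i *m g = f *m diff G i.
have [|i f [hf sf]|phi [phi0E Hphi]] := @dependent_choice_seq _ Q S phi0.
- split=> // b; apply/exH0; rewrite mulmxA E0 -col_mulmx aug_diff //.
  by apply/colP => k; rewrite !mxE.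
- have [||g [Eg hg]] :=
    @homog_factor _ _ _ _ _ (@degs G i.+1) (diff H i) (f *m diff G i) (dH i).
  + by move=> b; rewrite col_mulmx; apply: (homog_mulmx hf); apply: dG.
  + by move=> b; rewrite col_mulmx.
  exists g; split=> //; split=> // b; apply/exH.
  rewrite mulmxA Eg -mulmxA -col_mulmx diff_diff //.
  by apply/colP => k; rewrite !mxE big1 // => l _; rewrite !mxE mulr0.
exists phi; split=> [|i|i]; first by rewrite phi0E.
  by have [_ []] := Hphi i.
by have [[]] := Hphi i.
Qed.

Lemma chain_map_comp G H L phi psi : @chain_map G H phi -> @chain_map H L psi ->
  @chain_map G L (fun i => psi i *m phi i).
Proof.
move=> [a1 d1 h1] [a2 d2 h2]; split=> [|i|i b].
- by rewrite mulmxA a2.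
- by rewrite mulmxA d2 -mulmxA d1 mulmxA.
by rewrite col_mulmx; apply: (homog_mulmx (h2 i)); apply: h1.
Qed.

Definition unitfree_out G i : Prop :=
  if i is i'.+1 then const_part (diff G i') = 0 else True.

(** Both differentials adjacent to G_i vanish modulo the variables, so that the
    homology of G tensored with K at the place i is all of G_i tensored with K. *)
Definition unitfree_at G i : Prop :=
  const_part (diff G i) = 0 /\ unitfree_out G i.

(** X is the composite of the differential out of G_i with the homotopy one step
    below.  Its two properties suffice to continue the construction, so that the
    whole family of homotopies never has to be chosen. *)
Lemma endo_homotopic_id G theta i :
  graded_free_resolution d M G -> @chain_map G G theta ->
  exists h X, [/\ theta i - 1%:M = diff G i *m h + X, X *m diff G i = 0
    & unitfree_out G i -> const_part X = 0].
Proof.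
move=> rG [at0 dt ht]; have [_ _ _ ex0 ex] := rG.
elim: i => [|i [h [X [E Xd _]]]].
  have [|h Eh] := @factor _ _ _ (diff G 0) (theta 0%N - 1%:M).
    move=> b; apply/ex0; rewrite -col_mulmx mulmxBr mulmx1 at0 subrr.
    by apply/colP => k; rewrite !mxE.
  exists h, 0; split; rewrite ?addr0 ?mul0mx //.
  by move=> _; apply/matrixP => a b; rewrite !mxE mcoeff0.
have [|h' Eh'] := @factor _ _ _ (diff G i.+1) (theta i.+1 - 1%:M - h *m diff G i).
  move=> b; apply/ex; rewrite -col_mulmx !mulmxBr mulmx1 dt.
  have -> : theta i *m diff G i = diff G i + diff G i *m h *m diff G i.
    have /eqP := E; rewrite subr_eq addrC => /eqP ->.
    by rewrite !mulmxDl mul1mx Xd addr0.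
  by rewrite mulmxA addrAC addrK subrr; apply/colP => k; rewrite !mxE.
exists h', (h *m diff G i); split.
- by rewrite Eh' subrK.
- by rewrite -mulmxA diff_diff // mulmx0.
by move=> c0; rewrite const_partM c0 mulmx0.
Qed.

Lemma unitfree_endo G theta i :
  graded_free_resolution d M G -> @chain_map G G theta -> unitfree_at G i ->
  const_part (theta i) = 1%:M.
Proof.
move=> rG ct [c0 c1]; have [h [X [E _ /(_ c1) X0]]] := endo_homotopic_id i rG ct.
apply/eqP; rewrite -subr_eq0 -(@const_part1 K n) -const_partB E const_partD const_partM.
by rewrite c0 X0 mul0mx addr0.
Qed.

Lemma minimal_unitfree G i : minimal_free_resolution d M G -> unitfree_at G i.
Proof.
move=> [_ mG]; split; first by apply/const_part_eq0/mG.
by case: i => // i; apply/const_part_eq0/mG.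
Qed.

Lemma const_chain_map_graded G H phi i : @chain_map G H phi ->
  forall a b, const_part (phi i) a b != 0 -> degs a = degs b.
Proof.
move=> [_ _ h] a b; rewrite mxE => ne.
by have [|-> //] := @homog_const_entry _ _ _ (@degs H i) _ _ a (h i b); rewrite mxE.
Qed.

Lemma unitfree_gens G H i :
  graded_free_resolution d M G -> graded_free_resolution d M H ->
  unitfree_at G i -> unitfree_at H i ->
  forall j, gens_of_degree G i j = gens_of_degree H i j.
Proof.
move=> rG rH uG uH j.
have [phi cphi] := chain_map_exists rG rH.
have [psi cpsi] := chain_map_exists rH rG.
have E1 := unitfree_endo rG (chain_map_comp cphi cpsi) uG.
have E2 := unitfree_endo rH (chain_map_comp cpsi cphi) uH.
rewrite !const_partM in E1 E2.
apply/eqP; rewrite eqn_leq; apply/andP; split.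
  exact: graded_inverse_leq (const_chain_map_graded cphi) E1 j.
exact: graded_inverse_leq (const_chain_map_graded cpsi) E2 j.
Qed.

(** Modulo the variables, phi : G -> H has the left inverse psi; with equal ranks
    at i both are invertible there.  Since the differentials of G vanish modulo
    the variables, d_H phi = phi d_G and psi d_H = d_G psi then give that those
    of H vanish on both sides of H_i. *)
Lemma gens_unitfree G H i :
  minimal_free_resolution d M G -> graded_free_resolution d M H ->
  (forall j, gens_of_degree G i j = gens_of_degree H i j) -> unitfree_at H i.
Proof.
move=> mG rH eq_gens; have [rG _] := mG.
have [phi cphi] := chain_map_exists rG rH.
have [psi cpsi] := chain_map_exists rH rG.
have := unitfree_endo rG (chain_map_comp cphi cpsi) (minimal_unitfree i mG).
rewrite const_partM => E.
have eq_rk : rk G i = rk H i := eq_ranks_of_degree_counts eq_gens.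
have /eqP rk_phi : row_full (const_part (phi i)) by apply/row_fullP; eexists; exact: E.
have /eqP rk_psi : row_free (const_part (psi i)) by apply/row_freeP; eexists; exact: E.
split.
  have c0 : const_part (diff G i) = 0 by case: (minimal_unitfree i mG).
  have := congr1 (@const_part _ _ _ _) (cm_diff cpsi i).
  rewrite !const_partM c0 mul0mx => /esym e.
  by apply: (row_full_inj (A := const_part (psi i)));
    rewrite ?mulmx0 // /row_full rk_psi eq_rk.
case: i => // i in eq_gens E eq_rk rk_phi rk_psi *.
have c0 : const_part (diff G i) = 0 by case: (minimal_unitfree i.+1 mG).
have := congr1 (@const_part _ _ _ _) (cm_diff cphi i).
rewrite !const_partM c0 mulmx0 => /eqP.
by rewrite mulmx_free_eq0 ?/row_free ?rk_phi ?eq_rk // => /eqP.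
Qed.

End Comparison.

(** * The U-resolution *)

Section FromMarkedBases.
Variables (K : fieldType) (n m : nat) (d : 'I_m -> int).
Local Notation R := {mpoly K[n.+1]}.
Variables (U : 'cV[R]_m -> Prop) (P : seq (term n m)).
Hypothesis HP : pommaret_basis U P.

Lemma supp_outsideE v : supp_outside U v <-> reduced P v.
Proof.
have [_ _ UP _] := HP; split=> hv t ht; last by move/UP => [p pP]; apply: hv ht p pP.
by move=> p pP pt; apply: (hv t ht); apply/UP; exists p.
Qed.

(** Directness in each degree gives directness: the homogeneous parts of an
    element of the span of F are in the span too. *)
Lemma marked_basis_system (F : 'M[R]_(m, size P)) :
  marked_basis d U F -> marked_system d F.
Proof.
move=> [mF dF]; have [uP _ _ disjP] := HP.
have hF : homog_cols d (fun j => term_deg d (head P j)) F.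
  move=> j; have [[s hs] c1 _] := mF j.
  by rewrite (hs (head P j)) // c1 oner_eq0.
split=> // [j|j|v [c ->] /supp_outsideE rv].
- by have [] := mF j.
- by apply/supp_outsideE; have [] := mF j.
apply: (@hpart_eq0 _ _ _ d) => s; apply: (proj2 (dF s)).
- exact: hpart_homogeneous.
- by rewrite (hpart_mulmx hF); eexists.
move=> t; rewrite coef_hpart; case: ifP => _; last by rewrite eqxx.
exact: rv.
Qed.

Lemma col_terms_mx j : col j (terms_mx K P) = tvec K (head P j).
Proof. by apply/colP => k; rewrite !mxE. Qed.

(** A monomial module contains every term of the support of its elements, so a
    reduced element of U is 0. *)
Lemma terms_marked_system : marked_system d (terms_mx K P).
Proof.
have [uP gU UP disjP] := HP; split=> // [j|j|j|v sv rv].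
- by rewrite col_terms_mx; exact: homog_tvec.
- by rewrite col_terms_mx coef_tvec eqxx.
- by rewrite col_terms_mx subrr; exact: reduced0.
apply: coef_inj => t; rewrite vcoef0; apply/eqP; case: eqP => // /eqP ht.
have [p pP pt] : exists2 p, p \in P & term_cone p t; last by case: (rv t ht p pP).
apply/UP/gU; case: sv ht => c ->.
apply: (@vec_ind _ _ _ c (fun w => coef (terms_mx K P *m w) t != 0 ->
  span (terms_mx K P) (tvec K t))) => [|w1 w2 h1 h2|u _].
- by rewrite mulmx0 vcoef0 eqxx.
- by rewrite mulmxDr => /vcoefD_neq0[].
rewrite -scalemxAr mulmx_tvec => /vcoefC_neq0.
rewrite col_terms_mx tvecM => /coef_tvec_neq0 ->.
by rewrite -tvecM; apply: spanZ; rewrite -col_terms_mx; exact: span_col.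
Qed.

End FromMarkedBases.

Section UResolutions.
Variables (K : fieldType) (n m : nat) (d : 'I_m -> int) (P : seq (term n m)).
Local Notation R := {mpoly K[n.+1]}.
Variables (F : 'M[R]_(m, size P)) (HF : marked_system d F).
Variables (M : 'cV[R]_m -> Prop) (HM : generates F M).

Lemma stage_system t : marked_system (@shift n (U_stage d P t)) (U_elements d F t).
Proof. elim: t => [|t IH] //=; exact: marked_system_syzygies. Qed.

Lemma U_resolution_free : graded_free_resolution d M (U_resolution d F).
Proof.
split=> //.
- exact: ms_homogeneous HF.
- move=> i; exact: ms_homogeneous (stage_system i.+1).
- exact: ker_fund_syzygies HF.
- move=> i; exact: ker_fund_syzygies (stage_system i.+1).
Qed.

Lemma linear_heads t p : p \in heads (U_stage d P t.+1) -> exists l, p.1 = U_(l)%MM.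
Proof. by move/syz_headsP => [j [i [_ ->]]]; exists i. Qed.

Lemma const_part_step t : const_part (U_elements d F t.+1) = 0 ->
  const_part (U_elements d F t.+2) = 0.
Proof. apply: const_part_syzygies_step (stage_system t.+1) _; exact: linear_heads. Qed.

(** The differential into one place is the one out of the next, and vanishing
    modulo the variables passes upwards from any matrix whose heads are variables. *)
Lemma unitfree_U k i : unitfree_at (U_resolution d F) k -> (k <= i)%N ->
  unitfree_at (U_resolution d F) i.
Proof.
move=> uk; elim: i => [|i IH]; first by rewrite leqn0 => /eqP <-.
rewrite leq_eqVlt => /predU1P[<- //|/IH[c0 _]].
by split=> //; apply: const_part_step.
Qed.

Lemma U_minimalP :
  minimal_free_resolution d M (U_resolution d F) <-> minimal_generators F M.
Proof.
split=> [minU|minF].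
  apply: minimal_generators_of_const HM _ _.
    by move=> v /(ker_fund_syzygies HF); exact.
  by have [] := minimal_unitfree 0 minU.
split; first exact: U_resolution_free.
have c1 : const_part (U_elements d F 1) = 0.
  apply/matrixP => a b; rewrite [RHS]mxE mxE.
  have hb := ms_homogeneous (stage_system 1) (j := b).
  have := minimal_generators_no_units minF hb _ a; rewrite mxE; apply.
  by rewrite -col_mulmx (mulmx_fund_syzygies HF) col0.
move=> i; apply/const_part_eq0.
by have [] := @unitfree_U 0 i (conj c1 I) (leq0n i).
Qed.

Lemma betti_U_rank b k : betti_numbers d M b ->
  (forall j, b k j = U_rank d P k j) ->
  forall i, (k <= i)%N -> forall j, b i j = U_rank d P i j.
Proof.
move=> [G mG bG] bk i ki j; rewrite -bG.
have [rG _] := mG; have rU := U_resolution_free.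
apply: (unitfree_gens (H := U_resolution d F) rG rU).
  exact: minimal_unitfree mG.
apply: unitfree_U ki; apply: (gens_unitfree mG rU) => l.
by rewrite bG bk.
Qed.

Lemma minimal_betti_U_rank b : minimal_generators F M -> betti_numbers d M b ->
  forall i j, b i j = U_rank d P i j.
Proof.
move=> /U_minimalP mU [G mG bG] i j; rewrite -bG.
have [[rG _] [rU _]] := (mG, mU).
exact: unitfree_gens rG rU (minimal_unitfree i mG) (minimal_unitfree i mU) j.
Qed.

End UResolutions.

Theorem corollary3p8 (K : fieldType) (n m : nat) (d : 'I_m -> int)
    (U : 'cV[{mpoly K[n.+1]}]_m -> Prop) (P : seq ('X_{1..n.+1} * 'I_m))
    (HP : pommaret_basis U P)
    (F : 'M[{mpoly K[n.+1]}]_(m, size P)) (HF : marked_basis d U F)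
    (M : 'cV[{mpoly K[n.+1]}]_m -> Prop) (HM : generates F M) :
  [/\ minimal_free_resolution d M (U_resolution d F) <-> minimal_generators F M,
      forall bM : nat -> int -> nat, betti_numbers d M bM ->
      forall k : nat, (forall j : int, bM k j = U_rank d P k j) ->
      forall i : nat, (k <= i)%N -> forall j : int, bM i j = U_rank d P i j
    & stable U P ->
      forall bM bU : nat -> int -> nat,
      betti_numbers d M bM -> betti_numbers d U bU ->
      forall k : nat, (forall j : int, bM k j = bU k j) ->
      forall i : nat, (k <= i)%N -> forall j : int, bM i j = bU i j].
Proof.
have sF := marked_basis_system HP HF.
split; first exact: U_minimalP.
  by move=> bM hM k; exact: (betti_U_rank sF HM hM).
move=> [_ minP] bM bU hM hU k bk i ki j.
have [_ gU _ _] := HP.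
have bUE := minimal_betti_U_rank (terms_marked_system d HP) gU minP hU.
rewrite bUE; apply: (betti_U_rank sF HM hM) ki j => l.
by rewrite bk bUE.
Qed.
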